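(* Let $X=(X_t)_{t\ge0}$ be a Lévy process in $\mathbb{R}^d$ and let $f:\mathbb{R}^d\to\mathbb{R}$ be a measurable function such that for some locally bounded submultiplicative function $g:\mathbb{R}^d\to[0,\infty)$ one has $|f(x)|\le g(x)$ for all $x\in\mathbb{R}^d$. If the expectation $\mathbb{E}[g(X_t)]$ is finite for some $t>0$ and $(f(X_t))_{t\ge0}$ is a local martingale, then $(f(X_t))_{t\ge0}$ is a martingale.
   Context: A Lévy process is an $\mathbb{R}^d$-valued process with $X_0=0$, stationary and independent increments, and càdlàg paths. A function $g:\mathbb{R}^d\to[0,\infty)$ is submultiplicative if it is measurable and there is a constant $c\in[1,\infty)$ with $g(x+y)\le c\,g(x)g(y)$ for all $x,y\in\mathbb{R}^d$. (Local) martingales are understood with respect to the natural filtration $\mathcal{F}_t=\sigma(X_s,s\le t)$ of $X$. *)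

(* Defs.v *)
From HB Require Import structures.
From mathcomp Require Import all_boot all_order all_algebra.
From mathcomp Require Import all_classical all_reals all_analysis.

Set Implicit Arguments.
Unset Strict Implicit.
Unset Printing Implicit Defensive.

Import Order.TTheory GRing.Theory Num.Theory.
Import numFieldNormedType.Exports.

Local Open Scope classical_set_scope.
Local Open Scope ring_scope.

(* Matrices, in particular the vectors 'rV[R]_d of R^d, carry their Borel
   sigma-algebra. *)
HB.instance Definition _ (R : realType) (m n : nat) :=
  @isMeasurable.Build (sigma_display (@open 'M[R]_(m, n))) 'M[R]_(m, n)
    <<s @open 'M[R]_(m, n) >>
    (@sigma_algebra0 _ setT (@open 'M[R]_(m, n)))
    (@sigma_algebraC _ (@open 'M[R]_(m, n)))
    (@sigma_algebra_bigcup _ setT (@open 'M[R]_(m, n))).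

(* Processes are indexed by R, but only their values at times t >= 0 are ever
   constrained or used. *)

Section Processes.
Context {dO : measure_display} {Omega : measurableType dO} {R : realType}.
Variable P : probability Omega R.

(* Taking some of the B i equal to setT yields the product rule for every
   subfamily. *)
Definition independent_family {dT : measure_display} {T : measurableType dT}
    (n : nat) (Y : 'I_n -> Omega -> T) : Prop :=
  forall B : 'I_n -> set T, (forall i, measurable (B i)) ->
    P (\bigcap_(i in [set: 'I_n]) (Y i @^-1` B i)) =
    (\prod_(i < n) P (Y i @^-1` B i))%E.

Definition stationary_increments {d : nat}
    (X : R -> Omega -> 'rV[R]_d) : Prop :=
  forall s t : R, 0 <= s -> 0 <= t ->
  forall B : set 'rV[R]_d, measurable B ->
    pushforward P (X (s + t) \- X s) B = pushforward P (X t \- X 0) B.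

Definition independent_increments {d : nat}
    (X : R -> Omega -> 'rV[R]_d) : Prop :=
  forall (n : nat) (t : nat -> R), 0 <= t 0%N -> nondecreasing_seq t ->
    independent_family (fun i : 'I_n => X (t i.+1) \- X (t i)).

Definition cadlag {d : nat} (x : R -> 'rV[R]_d) : Prop :=
  (forall t, 0 <= t -> x s @[s --> t^'+] --> x t) /\
  (forall t, 0 < t -> cvg (x s @[s --> t^'-])).

Record levy_process {d : nat}
    (X : R -> Omega -> 'rV[R]_d) : Prop := {
  levy_measurable : forall t, 0 <= t -> measurable_fun setT (X t);
  levy_start : forall w, X 0 w = 0;
  levy_stationary : stationary_increments X;
  levy_independent : independent_increments X;
  levy_cadlag : forall w, cadlag (X ^~ w) }.

Definition natural_filtration {d : nat} (X : R -> Omega -> 'rV[R]_d) (t : R) :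
    set (set Omega) :=
  <<s \bigcup_(s in `[0, t]) preimage_set_system setT (X s) measurable >>.

Definition measurable_wrt (G : set (set Omega)) (Y : Omega -> R) : Prop :=
  forall B : set R, measurable B -> G (Y @^-1` B).

(* Z is a version of the conditional expectation E[Y | G] of the integrable
   random variable Y. *)
Definition is_cond_expectation (G : set (set Omega)) (Y Z : Omega -> R) : Prop :=
  [/\ measurable_wrt G Z,
      P.-integrable setT (EFin \o Z) &
      forall A, G A -> (\int[P]_(w in A) (Z w)%:E = \int[P]_(w in A) (Y w)%:E)%E].

Definition adapted (F : R -> set (set Omega)) (M : R -> Omega -> R) : Prop :=
  forall t, 0 <= t -> measurable_wrt (F t) (M t).

Record martingale (F : R -> set (set Omega)) (M : R -> Omega -> R) : Prop := {
  martingale_adapted : adapted F M;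
  martingale_integrable :
    forall t, 0 <= t -> P.-integrable setT (EFin \o M t);
  martingale_cond :
    forall s t, 0 <= s -> s <= t -> is_cond_expectation (F s) (M t) (M s) }.

Definition stopping_time (F : R -> set (set Omega))
    (tau : Omega -> \bar R) : Prop :=
  (forall w, (0 <= tau w)%E) /\
  (forall t, 0 <= t -> F t [set w | (tau w <= t%:E)%E]).

(* M at time min(t, tau); the minimum is finite when t, tau >= 0. *)
Definition stopped (M : R -> Omega -> R) (tau : Omega -> \bar R)
    (t : R) (w : Omega) : R :=
  M (fine (mine t%:E (tau w))) w.

(* No path regularity of M is required: M = f(X) with f merely measurable
   need not be cadlag. *)
Definition local_martingale (F : R -> set (set Omega))
    (M : R -> Omega -> R) : Prop :=
  adapted F M /\
  exists tau : nat -> Omega -> \bar R,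
    [/\ forall n, stopping_time F (tau n),
        {ae P, forall w, nondecreasing_seq (tau ^~ w)},
        {ae P, forall w, tau n w @[n --> \oo] --> +oo%E} &
        forall n, martingale F (stopped M (tau n))].

End Processes.

Definition submultiplicative {R : realType} {d : nat} (g : 'rV[R]_d -> R) : Prop :=
  [/\ measurable_fun setT g, forall x, 0 <= g x &
      exists2 c : R, 1 <= c & forall x y, g (x + y) <= c * g x * g y].

Definition locally_bounded {R : realType} {d : nat} (g : 'rV[R]_d -> R) : Prop :=
  forall x : 'rV[R]_d, bounded_near g (nbhs x).

(* Main.v *)
(* With M = f(X), every stopping time tau for which the stopped process is a
   martingale satisfies
     E[|M_(t /\ tau)|; tau <= t] <= C E[g(X_t); tau <= t]
   with C independent of tau. Indeed cadlag paths are bounded on [0, t], so for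
   some r the increment X_t - X_u has norm at most r with probability at least
   1/2 for every u in [0, t], and on the event |X_t - X_tau| <= r one has
   g(X_tau) <= K g(X_t) by submultiplicativity and local boundedness. Since
   X_t - X_tau is independent of the past of tau, restricting to that event
   costs at most a factor 2. As g is not continuous, tau is discretised only in
   the increment X_t - X_tau, never in M_tau, and dominated convergence passes
   to the limit. The same comparison at fixed times, with independence for the
   doubling s -> 2s, propagates the finite moment from one time to all times.
   For tau = tau_n -> +oo the right-hand side tends to 0, so M_(t /\ tau_n)
   tends to M_t in L^1 and the martingale property passes to the limit. *)
Require Import Defs.
From mathcomp Require Import all_boot all_order all_algebra.
From mathcomp Require Import all_classical all_reals all_analysis.
From mathcomp Require Import measurable_realfun lra.

Set Implicit Arguments.
Unset Strict Implicit.
Unset Printing Implicit Defensive.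

Import Order.TTheory GRing.Theory Num.Theory.
Import numFieldNormedType.Exports.

Local Open Scope classical_set_scope.
Local Open Scope ring_scope.

(** * Topology and Borel sets of R^d *)

(** The bound near [x] is asked only at points of [A], so an endpoint of an interval needs control
    from one side only. Compactness enters as the near-covering property along the filter of large
    [M]. *)
Lemma compact_locally_bounded (T : topologicalType) (R : numFieldType)
    (V : pseudoMetricNormedZmodType R) (h : T -> V) (A : set T) :
  compact A ->
  (forall x, A x -> \forall M \near +oo, \forall y \near x, A y -> `|h y| <= M) ->
  exists M, forall x, A x -> `|h x| <= M.
Proof.
move=> /compact_near_coveringP cA hA.
have := cA R (pinfty_nbhs R) (fun M y => A y -> `|h y| <= M) _.
case.
  move=> x Ax; have [M1 [M1r hM1]] := hA x Ax.
  exists ([set y | A y -> `|h y| <= M1 + 1], [set M | M1 + 1 < M]).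
    split; first by apply: hM1; rewrite ltrDl.
    by exists (M1 + 1); split => //; rewrite realD.
  by move=> [y M] /= [hy /ltW M1M] Ay; exact: le_trans (hy Ay) M1M.
move=> M [Mr hM]; exists (M + 1) => x Ax; apply: hM => //.
by rewrite /= ltrDl.
Qed.

Lemma measurable_coord (R : realType) (d : nat) (i : 'I_d) :
  measurable_fun setT (fun x : 'rV[R]_d => x ord0 i).
Proof.
apply: (measurability _ (RGenOpens.measurableE R)) => _ [_ [a [b ->] <-]].
rewrite setTI; apply: sub_sigma_algebra.
by apply: open_comp; [move=> x _; exact: coord_continuous|exact: interval_open].
Qed.

(** The Borel sets are generated by the open sets; this union over a countable type reduces their
    measurability to that of balls. *)
Lemma open_bigcup_ball_rat (R : realType) (d : nat) (U : set 'rV[R]_d) :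
  open U -> U = \bigcup_(p in [set p : 'rV[rat]_d * nat |
      ball (map_mx ratr p.1 : 'rV[R]_d) p.2.+1%:R^-1 `<=` U])
    ball (map_mx ratr p.1 : 'rV[R]_d) p.2.+1%:R^-1.
Proof.
move=> oU; apply/seteqP; split; last by move=> x [p pU /pU].
move=> x Ux; have /nbhs_ballP[e /= e0 xeU] := open_nbhs_nbhs (conj oU Ux).
have [n _ /(_ n (leqnn n)) /= ne] :=
  near_infty_natSinv_lt (PosNum (divr_gt0 e0 (ltr0n _ 2))).
pose B i := ball (x ord0 i) n.+1%:R^-1.
have n0 : 0 < n.+1%:R^-1 :> R by rewrite invr_gt0 ltr0n.
have q_ i : exists q : rat, B i (ratr q).
  have [y [By [q _ qy]]] : B i `&` (@ratr R @` setT) !=set0.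
    apply: dense_rat; last exact: ball_open.
    by exists (x ord0 i); exact: ballxx.
  by exists q; rewrite qy.
pose q : 'rV[rat]_d := \row_i projT1 (cid (q_ i)).
have qx : ball (map_mx ratr q : 'rV[R]_d) n.+1%:R^-1 x.
  split => // i j; rewrite !mxE /= ord1; apply: ball_sym.
  exact: (projT2 (cid (q_ j))).
exists (q, n) => // y /= qy; apply: xeU.
rewrite (splitr e).
apply: (ball_triangle (le_ball (ltW ne) (ball_sym qx))).
exact: le_ball (ltW ne) _ qy.
Qed.

(** Balls of ['rV[R]_d] are entrywise, hence products of intervals, so the preimage of a ball is a
    finite intersection of coordinate preimages. *)
Lemma measurable_fun_rV (dT : measure_display) (T : measurableType dT)
    (R : realType) (d : nat) (F : T -> 'rV[R]_d) :
  (forall i, measurable_fun setT (fun x => F x ord0 i)) ->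
  measurable_fun setT F.
Proof.
move=> mF; apply: (measurability (@open 'rV[R]_d)) => // _ [U oU <-].
rewrite setTI (open_bigcup_ball_rat oU) preimage_bigcup bigcup_mkcond.
apply: countable_bigcupT_measurable => // -[q n].
case: ifP => // _.
rewrite [X in measurable X](_ : _ = \bigcap_(i in [set: 'I_d])
    ((fun x => F x ord0 i) @^-1` ball (ratr (q ord0 i) : R) n.+1%:R^-1)).
  apply: fin_bigcap_measurable => // i _; rewrite -[X in measurable X]setTI.
  by apply: mF => //; exact: open_measurable (ball_open _ _).
apply/seteqP; split=> x /=.
  by move=> [_ qx] i _; have := qx ord0 i; rewrite mxE.
by move=> qx; split=> [|k i]; [rewrite invr_gt0|rewrite ord1 mxE; exact: qx].
Qed.

Lemma measurable_fun_rVD (dT : measure_display) (T : measurableType dT)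
    (R : realType) (d : nat) (F G : T -> 'rV[R]_d) :
  measurable_fun setT F -> measurable_fun setT G ->
  measurable_fun setT (F \+ G).
Proof.
move=> mF mG; apply: measurable_fun_rV => i.
rewrite (_ : (fun x => _) = (fun x => F x ord0 i) \+ (fun x => G x ord0 i)).
  apply: measurable_funD.
    exact: measurableT_comp (measurable_coord i) mF.
  exact: measurableT_comp (measurable_coord i) mG.
by apply/funext => x; rewrite mxE.
Qed.

Lemma measurable_fun_rVB (dT : measure_display) (T : measurableType dT)
    (R : realType) (d : nat) (F G : T -> 'rV[R]_d) :
  measurable_fun setT F -> measurable_fun setT G ->
  measurable_fun setT (F \- G).
Proof.
move=> mF mG; apply: measurable_fun_rV => i.
rewrite (_ : (fun x => _) = (fun x => F x ord0 i) \- (fun x => G x ord0 i)).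
  apply: measurable_funB.
    exact: measurableT_comp (measurable_coord i) mF.
  exact: measurableT_comp (measurable_coord i) mG.
by apply/funext => x; rewrite !mxE.
Qed.

Lemma measurable_norm_le (R : realType) (d : nat) (r : R) :
  measurable [set x : 'rV[R]_d | `|x| <= r].
Proof.
rewrite (_ : [set x | _] = ~` ((fun x : 'rV[R]_d => `|x|) @^-1` [set y | r < y])).
  apply: measurableC; apply: sub_sigma_algebra; apply: open_comp.
    by move=> x _; exact: norm_continuous.
  exact: open_gt.
by apply/seteqP; split => x /=; [move=> xr /lt_geF; rewrite xr|move/negP; rewrite -leNgt].
Qed.

Lemma cadlag_bounded (R : realType) (d : nat) (x : R -> 'rV[R]_d) (t : R) :
  cadlag x -> exists M, forall s, 0 <= s <= t -> `|x s| <= M.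
Proof.
move=> [xr xl].
have [|M hM] := @compact_locally_bounded R R 'rV[R]_d x `[0, t]
    (@segment_compact _ _ _); last first.
  by exists M => s st; apply: hM; rewrite /= in_itv.
move=> s; rewrite /= in_itv /= => /andP[s0 _].
have br : \forall M \near +oo, \forall y \near s^'+, `|x y| <= M.
  exact: cvg_bounded _ _ (xr s s0).
have bl : \forall M \near +oo, \forall y \near s^'-, 0 <= y <= t -> `|x y| <= M.
  move: s0; rewrite le_eqVlt => /predU1P[<-|s0].
    (* At [s = 0] no left limit is available, but the points of a left neighbourhood are negative
       and so lie outside [[0, t]]. *)
    near=> M; near=> y => /andP[y0]; suff : y < 0 by rewrite ltNge y0.
    by near: y; exact: nbhs_left_lt.
  have b := cvg_bounded _ _ (xl s s0); near=> M.
  have : \forall y \near s^'-, `|x y| <= M by near: M; exact: b.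
  by apply: filterS => y + _.
near=> M.
have bs : `|x s| <= M by near: M; apply: nbhs_pinfty_ge; rewrite num_real.
have : \forall y \near s^'+, `|x y| <= M by near: M.
have : \forall y \near s^'-, 0 <= y <= t -> `|x y| <= M by near: M.
rewrite !near_withinE => bL bR.
apply: filterS (filterI bL bR) => y [hL hR] y0t.
by have [/hL/(_ y0t)|/hR|->] := ltgtP y s.
Unshelve. all: by end_near. Qed.

(** * Independence *)

(** Both sides, as functions of [A], are finite measures that agree on the pi-system [G], hence on
    the sigma-algebra it generates. *)
Lemma indep_g_sigma_algebra (dO : measure_display) (Omega : measurableType dO)
    (R : realType) (P : probability Omega R) (G : set (set Omega))
    (B : set Omega) :
  setI_closed G -> G setT -> G `<=` measurable -> measurable B ->
  (forall A, G A -> P (A `&` B) = (P A * P B)%E) ->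
  forall A, <<s G >> A -> P (A `&` B) = (P A * P B)%E.
Proof.
move=> GI GT Gm mB GB A GA; rewrite muleC.
have [r PBr] : exists r : {nonneg R}, P B = r%:num%:E.
  have PB0 : 0 <= fine (P B) by rewrite fine_ge0.
  by exists (NngNum PB0); rewrite /= fineK// fin_num_measure.
rewrite PBr.
apply: (g_sigma_algebra_measure_unique G Gm (fun _ => setT) (fun=> GT) _
  (mrestr P mB) (mscale r P)) => //.
- by apply: bigcup_const; exists 0%N.
- by move=> C /GB; rewrite PBr muleC.
- move=> _; change (P (setT `&` B) < +oo)%E.
  by rewrite setTI ltey_eq fin_num_measure.
Qed.

(** Independence makes the joint law of [(U, V)] the product of the marginal laws; Tonelli's theorem
    then splits the integral. *)
Lemma integralM_indep (dO d1 d2 : measure_display) (Omega : measurableType dO)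
    (T1 : measurableType d1) (T2 : measurableType d2) (R : realType)
    (P : probability Omega R) (U : Omega -> T1) (V : Omega -> T2)
    (y : T1 -> \bar R) (z : T2 -> \bar R) :
  measurable_fun setT U -> measurable_fun setT V ->
  (forall A B, measurable A -> measurable B ->
    P (U @^-1` A `&` V @^-1` B) = (P (U @^-1` A) * P (V @^-1` B))%E) ->
  measurable_fun setT y -> measurable_fun setT z ->
  (forall x, 0 <= y x)%E -> (forall x, 0 <= z x)%E ->
  (\int[P]_w (y (U w) * z (V w)) = \int[P]_w y (U w) * \int[P]_w z (V w))%E.
Proof.
move=> mU mV UV my mz y0 z0.
pose U' : {mfun Omega >-> T1} := mfun_Sub (mem_set mU).
pose V' : {mfun Omega >-> T2} := mfun_Sub (mem_set mV).
have mW : measurable_fun setT (fun w => (U w, V w)).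
  exact: measurable_fun_pair.
pose W : {mfun Omega >-> (T1 * T2)%type} := mfun_Sub (mem_set mW).
pose h (p : T1 * T2) := (y p.1 * z p.2)%E.
have h0 p : (0 <= h p)%E by rewrite mule_ge0.
have mh : measurable_fun setT h.
  apply: emeasurable_funM.
    exact: measurableT_comp my measurable_fst.
  exact: measurableT_comp mz measurable_snd.
transitivity (\int[distribution P W]_p h p)%E.
  by rewrite ge0_integral_distribution.
transitivity (\int[distribution P U' \x distribution P V']_p h p)%E.
  apply: eq_measure_integral => A mA _; apply/esym.
  apply: product_measure_unique mA => A1 A2 mA1 mA2.
  exact: UV.
rewrite fubini_tonelli1// /fubini_F /h /=.
under eq_integral do rewrite ge0_integralZl//.
rewrite ge0_integralZr//; last exact: integral_ge0.
by rewrite !ge0_integral_distribution.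
Qed.

Lemma sub_sigma_algebra_measurable (d : measure_display) (T : measurableType d)
    (G : set (set T)) : G `<=` measurable -> <<s G >> `<=` measurable.
Proof. by move=> Gm; apply: smallest_sub => //; exact: sigma_algebra_measurable. Qed.

(** The cylinder sets of the first [n] variables: a pi-system that generates their joint
    sigma-algebra. *)
Definition rectangles (dO dT : measure_display) (Omega : measurableType dO)
    (T : measurableType dT) (n : nat) (Z : nat -> Omega -> T) : set (set Omega) :=
  [set A | exists2 B : nat -> set T, forall i, measurable (B i) &
    A = \bigcap_(i in [set k | (k < n)%N]) (Z i @^-1` B i)].

Lemma rectangles_setI (dO dT : measure_display) (Omega : measurableType dO)
    (T : measurableType dT) (n : nat) (Z : nat -> Omega -> T) :
  setI_closed (rectangles n Z).
Proof.
move=> _ _ [B1 mB1 ->] [B2 mB2 ->]; exists (fun i => B1 i `&` B2 i).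
  by move=> i; exact: measurableI.
by rewrite -bigcapI; apply: eq_bigcapr.
Qed.

(** * Increments of a Levy process *)

Section LevyIncrements.
Context {dO : measure_display} {Omega : measurableType dO} {R : realType}.
Context {P : probability Omega R} {d : nat} {X : R -> Omega -> 'rV[R]_d}.
Context (LX : levy_process P X).

Lemma levy_increment_measurable (s t : R) :
  0 <= s -> 0 <= t -> measurable_fun setT (X t \- X s).
Proof.
by move=> s0 t0; apply: measurable_fun_rVB; exact: (levy_measurable LX).
Qed.

Lemma preimage_increment_measurable (s t : R) (B : set 'rV[R]_d) :
  0 <= s -> 0 <= t -> measurable B -> measurable ((X t \- X s) @^-1` B).
Proof.
move=> s0 t0 mB; rewrite -[X in measurable X]setTI.
exact: levy_increment_measurable.
Qed.

Let incr (t : nat -> R) (i : nat) := X (t i.+1) \- X (t i).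

Lemma incr_indep (t : nat -> R) (n : nat) (B : set 'rV[R]_d) :
  0 <= t 0%N -> nondecreasing_seq t -> measurable B ->
  forall A, <<s rectangles n (incr t) >> A ->
  P (A `&` incr t n @^-1` B) = (P A * P (incr t n @^-1` B))%E.
Proof.
move=> t0 nt mB.
have t_ge0 i : 0 <= t i by exact: le_trans t0 (nt _ _ (leq0n i)).
have mZ i (C : set 'rV[R]_d) : measurable C -> measurable (incr t i @^-1` C).
  exact: preimage_increment_measurable.
apply: indep_g_sigma_algebra.
- exact: rectangles_setI.
- exists (fun=> setT) => //; apply/seteqP; split => // w _ i _ //.
- move=> _ [C mC ->]; apply: fin_bigcap_measurable => [|i _]; last exact: mZ.
  exact: finite_II.
- exact: mZ.
move=> _ [C mC ->].
have prodE (D : set 'rV[R]_d) : measurable D ->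
    P (\bigcap_(i in [set k | (k < n)%N]) (incr t i @^-1` C i) `&`
       incr t n @^-1` D) =
    (\prod_(i < n) P (incr t i @^-1` C i) * P (incr t n @^-1` D))%E.
  (* The product rule for [n.+1] increments is used with [D] in the last slot. *)
  move=> mD; pose C' (i : 'I_n.+1) := if (i < n)%N then C i else D.
  have mC' i : measurable (C' i) by rewrite /C'; case: ifP.
  have := levy_independent LX t0 nt mC'.
  rewrite big_ord_recr /= {3}/C' /= ltnn.
  under eq_bigr do rewrite /C' /= ltn_ord.
  move=> <-; congr (P _); apply/seteqP; split=> w /=.
    move=> [CW DW] i _; rewrite /C'; case: ifPn => [|iN]; first exact: CW.
    by have -> : nat_of_ord i = n by apply/eqP; rewrite eqn_leq -ltnS ltn_ord leqNgt.
  move=> CW; split=> [i iN|].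
    by have := CW (Ordinal (ltnW iN : i < n.+1)%N) I; rewrite /C' /= iN.
  by have := CW ord_max I; rewrite /C' /= ltnn.
rewrite prodE//; congr (_ * _)%E.
(* For [D = setT] the same rule identifies the remaining product with the probability of the
   rectangle. *)
by have := prodE _ measurableT; rewrite preimage_setT setIT probability_setT mule1.
Qed.

(** Since the process starts at 0, [X (t i)] is the sum of the first [i] increments. *)
Lemma measurable_incr_rectangles (t : nat -> R) (n i : nat) :
  t 0%N = 0 -> (i <= n)%N ->
  measurable_fun setT (X (t i) : g_sigma_algebraType (rectangles n (incr t)) -> _).
Proof.
move=> t0; elim: i => [_|i IHi iN].
  rewrite t0 (_ : X 0 = cst 0); first by [].
  by apply/funext => w; exact: (levy_start LX).
rewrite (_ : X (t i.+1) = X (t i) \+ incr t i); last first.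
  by apply/funext => w; rewrite /incr /= addrC subrK.
apply: measurable_fun_rVD; first by apply: IHi; exact: ltnW.
move=> _ B mB; rewrite setTI; apply: sub_sigma_algebra.
exists (fun j => if j == i then B else setT) => [j|]; first by case: ifP.
apply/seteqP; split=> w /= Bw; last by have := Bw i iN; rewrite eqxx.
by move=> j _; case: eqP => // ->.
Qed.

Definition sigma_at (L : seq R) : set (set Omega) :=
  <<s \bigcup_(u in [set` L]) preimage_set_system setT (X u) measurable >>.

(** Sorting the times of [L] together with 0 and [s] turns each [X v], [v] in [L], into a sum of
    increments that precede [X t \- X s]. *)
Lemma sigma_at_indep (L : seq R) (s t : R) (A : set Omega) (B : set 'rV[R]_d) :
  s <= t -> {in L, forall u, 0 <= u <= s} -> 0 <= s -> sigma_at L A ->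
  measurable B ->
  P (A `&` (X t \- X s) @^-1` B) = (P A * P ((X t \- X s)%R @^-1` B))%E.
Proof.
move=> st Ls s0 LA mB.
pose S := sort <=%O (0 :: s :: L).
have S_size : size S = (size L).+2 by rewrite size_sort.
have memS u : (u \in S) = [|| u == 0, u == s | u \in L] by rewrite mem_sort !inE.
have S0s u : u \in S -> 0 <= u <= s.
  by rewrite memS => /or3P[/eqP->|/eqP->|/Ls//]; rewrite s0 lexx.
have nondecS : {in [pred k | (k < size S)%N] &,
    {homo nth t S : i j / (i <= j)%N >-> i <= j}}.
  move=> i j iS jS ij.
  apply: (sorted_leq_nth le_trans lexx) => //.
  exact: (sort_sorted le_total).
(* The default value [t] prolongs the sorted times: [u] starts at 0, equals [s] at the last index
   [(size L).+1] of [S], and is constantly [t] afterwards. *)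
pose u k := nth t S k.
have u0 : u 0%N = 0.
  apply/eqP; rewrite eq_le; apply/andP; split.
    have /(nthP t)[k kS <-] : 0 \in S by rewrite memS eqxx.
    by apply: nondecS => //; rewrite inE S_size.
  by have /S0s/andP[] : u 0%N \in S by apply: mem_nth; rewrite S_size.
have us : u (size L).+1 = s.
  apply/eqP; rewrite eq_le; apply/andP; split.
    by have /S0s/andP[] : u (size L).+1 \in S by apply: mem_nth; rewrite S_size.
  have /(nthP t)[k kS <-] : s \in S by rewrite memS eqxx orbT.
  have kL : (k <= (size L).+1)%N by rewrite -ltnS -S_size.
  by apply: nondecS => //; rewrite inE S_size.
have ut : u (size L).+2 = t by rewrite /u nth_default// S_size.
have ndu : nondecreasing_seq u.
  move=> i j ij; have [jS|Sj] := ltnP j (size S).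
    by apply: nondecS => //; exact: leq_ltn_trans jS.
  rewrite /u (nth_default _ Sj); have [iS|Si] := ltnP i (size S).
    by have /S0s/andP[_ /le_trans->] := mem_nth t iS.
  by rewrite nth_default.
have := @incr_indep u (size L).+1 B _ ndu mB A; rewrite {1}u0 /incr ut us; apply => //.
move: A LA; apply: smallest_sub; first exact: smallest_sigma_algebra.
move=> _ [v /= vL [C mC <-]].
have /(nthP t)[k kS <-] : v \in S by rewrite memS vL !orbT.
apply: (@measurable_incr_rectangles u) => //.
by rewrite -ltnS -S_size.
Qed.

(* The sigma-algebras generated by finitely many of the variables [X u] form a
   directed family, so their union is a pi-system generating the past. *)
Lemma levy_indep_past (s t : R) (A : set Omega) (B : set 'rV[R]_d) :
  0 <= s -> s <= t -> natural_filtration X s A -> measurable B ->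
  P (A `&` (X t \- X s) @^-1` B) = (P A * P ((X t \- X s)%R @^-1` B))%E.
Proof.
move=> s0 st FA mB.
pose G := [set A | exists2 L : seq R, {in L, forall u, 0 <= u <= s} & sigma_at L A].
have sub2 L1 L2 : {subset L1 <= L2} -> sigma_at L1 `<=` sigma_at L2.
  move=> L12; apply: sub_sigma_algebra2; exact: bigcup_subset.
apply: (@indep_g_sigma_algebra _ _ _ _ G) => //.
- move=> A1 A2 [L1 L1s A1m] [L2 L2s A2m]; exists (L1 ++ L2).
    by move=> u; rewrite mem_cat => /orP[/L1s|/L2s].
  apply: (@measurableI _ (g_sigma_algebraType (\bigcup_(u in [set` L1 ++ L2])
      preimage_set_system setT (X u) measurable))).
    by apply: sub2 A1m => u uL; rewrite mem_cat uL.
  by apply: sub2 A2m => u uL; rewrite mem_cat uL orbT.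
- exists [::] => //.
  exact: (@measurableT _ (g_sigma_algebraType (\bigcup_(u in [set` [::]])
      preimage_set_system setT (X u) measurable))).
- move=> A1 [L Ls]; apply: sub_sigma_algebra_measurable => _ [u /= uL [C mC <-]].
  by apply: (levy_measurable LX) => //; have /andP[] := Ls u uL.
- by apply: preimage_increment_measurable => //; exact: le_trans s0 st.
- by move=> A1 [L Ls LA]; exact: sigma_at_indep LA mB.
move: A FA; apply: sub_sigma_algebra2 => A1 [u /= us A1u].
exists [:: u]; last by apply: sub_sigma_algebra; exists u => //=; rewrite inE.
by move=> v; rewrite inE => /eqP ->; move: us; rewrite in_itv.
Qed.

Lemma natural_filtration_measurable (s : R) :
  natural_filtration X s `<=` measurable.
Proof.
apply: sub_sigma_algebra_measurable => _ [u /= us [C mC <-]].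
apply: (levy_measurable LX) => //.
by move: us; rewrite in_itv /= => /andP[].
Qed.

Lemma levy_stationaryE (s t : R) (B : set 'rV[R]_d) :
  0 <= s -> s <= t -> measurable B ->
  P ((X t \- X s) @^-1` B) = P (X (t - s) @^-1` B).
Proof.
move=> s0 st mB.
have ts0 : 0 <= t - s by rewrite subr_ge0.
have := levy_stationary LX s0 ts0 mB.
rewrite /pushforward (addrC s) subrK => ->.
by congr (P _); apply/seteqP; split=> w /=; rewrite (levy_start LX) subr0.
Qed.

(** Otherwise some times [u n] in [[0, T]] have [|X (u n)| > n] with probability at least 1/2, and
    then so has the event [F n] that this happens for some [k >= n]. The events [F n] decrease to
    the empty set, because each path is bounded on [[0, T]]; this contradicts continuity from
    above. *)
Lemma levy_tight (T : R) :
  exists r : R, forall u, 0 <= u <= T ->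
    (2^-1%:E <= P (X u @^-1` [set x | (`|x| <= r)%R]))%E.
Proof.
apply: contrapT => /forallNP nT.
have /choice[u uT] : forall n : nat, exists u, 0 <= u <= T /\
    (P (X u @^-1` [set x | (`|x| <= n%:R)%R]) < 2^-1%:E)%E.
  move=> n; have /existsNP[u /not_implyP[u0T /negP]] := nT n%:R.
  by rewrite -ltNge => ?; exists u.
pose E k := X (u k) @^-1` [set x | (`|x| <= k%:R)%R].
have mE k : measurable (E k).
  rewrite -[X in measurable X]setTI; apply: (levy_measurable LX) => //.
    by have [/andP[]] := uT k.
  exact: measurable_norm_le.
pose F n := \bigcup_(k in [set k | (n <= k)%N]) ~` E k.
have mF n : measurable (F n).
  by apply: bigcup_measurable => k _; exact: measurableC.
have F0 : \bigcap_n F n = set0.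
  apply/seteqP; split => // w Fw.
  have [M xM] := cadlag_bounded T (levy_cadlag LX w).
  have [k] := Fw (Num.truncn `|M|).+1 I.
  rewrite /= => Mk; apply; rewrite /E /=.
  apply: (le_trans (xM _ (uT k).1)); apply: (le_trans (ler_norm M)).
  apply/ltW/(lt_le_trans (truncnS_gt _)); rewrite ler_nat.
  exact: Mk.
have : P \o F @ \oo --> P (\bigcap_n F n).
  apply: nonincreasing_cvg_mu => //.
  - by rewrite ltey_eq fin_num_measure.
  - by rewrite F0.
  - move=> n m nm; apply/subsetPset; apply: bigcup_subset => k /=.
    exact: leq_trans.
rewrite F0 measure0 => /cvge_to_ge H.
have : (2^-1%:E <= 0 :> \bar R)%E.
  apply: H; near=> n => /=.
  apply: (@le_trans _ _ (P (~` E n))); last first.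
    apply: le_measure; rewrite ?inE//; first exact: measurableC.
    by move=> w Ew; exists n => //=.
  rewrite probability_setC//; have := ltW (uT n).2; rewrite -/(E n).
  have /fineK <- : P (E n) \is a fin_num by exact: fin_num_measure.
  by rewrite -EFinB !lee_fin => h; lra.
by rewrite lee_fin leNgt invr_gt0 ltr0n.
Unshelve. all: by end_near. Qed.
End LevyIncrements.

(** * Submultiplicative moments *)

(** Writing [y = x + (y - x)] gives [g y <= c * g x * g (y - x)], and [g] is bounded on the compact
    ball of radius [r]. *)
Lemma submultiplicative_comparable (R : realType) (d : nat)
    (g : 'rV[R]_d -> R) (r : R) :
  submultiplicative g -> locally_bounded g ->
  exists2 K : R, 0 <= K & forall x y, `|x - y| <= r -> g y <= K * g x.
Proof.
move=> [_ g0 [c c1 gM]] gloc.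
have cB : compact [set x : 'rV[R]_d | `|x| <= r].
  apply: bounded_closed_compact.
    by exists r; split; rewrite ?num_real// => M rM x /= /le_trans; apply; exact: ltW.
  rewrite (_ : [set x | _] = (fun x : 'rV[R]_d => `|x|) @^-1` [set y | y <= r])//.
  by apply: closed_comp => [x _|]; [exact: norm_continuous|exact: closed_le].
have [|M gM_] := compact_locally_bounded (h := g) cB.
  move=> x _; have gx := gloc x; near=> M.
  have : \forall y \near x, `|g y| <= M by near: M; exact: gx.
  by apply: filterS => y + _.
have c0 : 0 <= c by exact: le_trans c1.
exists (c * `|M|); first by rewrite mulr_ge0.
move=> x y xyr; rewrite -(subrK x y) addrC.
apply: (le_trans (gM _ _)); rewrite mulrAC ler_wpM2r// ler_wpM2l//.
apply: (le_trans (ler_norm _)); apply: le_trans (ler_norm M).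
by apply: gM_; rewrite /= distrC.
Unshelve. all: by end_near. Qed.

(* [Omega] with the sigma-algebra [natural_filtration X s]: a function on it is
   measurable iff it is F_s-measurable on [Omega]. *)
Local Notation past X s := (g_sigma_algebraType
  (\bigcup_(u in `[0, s]) preimage_set_system setT (X u) measurable)).

Section LevyMoments.
Context {dO : measure_display} {Omega : measurableType dO} {R : realType}.
Context {P : probability Omega R} {d : nat} {X : R -> Omega -> 'rV[R]_d}.
Context (LX : levy_process P X).

Lemma levy_integralM (s t : R) (y : Omega -> \bar R) (h : 'rV[R]_d -> \bar R) :
  0 <= s -> s <= t -> measurable_fun setT (y : past X s -> \bar R) ->
  measurable_fun setT h -> (forall w, 0 <= y w)%E -> (forall x, 0 <= h x)%E ->
  (\int[P]_w (y w * h (X t w - X s w)%R) =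
   \int[P]_w y w * \int[P]_w h (X (t - s)%R w))%E.
Proof.
move=> s0 st my mh y0 h0.
have t0 := le_trans s0 st; have ts0 : 0 <= t - s by rewrite subr_ge0.
have mV := levy_increment_measurable LX s0 t0.
have mXts := levy_measurable LX ts0.
(* By stationarity [X (t - s)] and [X t \- X s] have the same law. *)
have -> : (\int[P]_w h (X (t - s)%R w) = \int[P]_w h (X t w - X s w)%R)%E.
  pose V1 : {mfun Omega >-> 'rV[R]_d} := mfun_Sub (mem_set mXts).
  pose V2 : {mfun Omega >-> 'rV[R]_d} := mfun_Sub (mem_set mV).
  transitivity (\int[distribution P V1]_x h x)%E.
    by rewrite ge0_integral_distribution.
  transitivity (\int[distribution P V2]_x h x)%E.
    by apply: eq_measure_integral => B mB _; exact/esym/(levy_stationaryE LX).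
  by rewrite ge0_integral_distribution.
(* The identity into [Omega] with the smaller sigma-algebra treats the whole past as a single random
   element, independent of the increment. *)
have mU : measurable_fun setT (id : Omega -> past X s).
  by move=> _ B mB; rewrite setTI; exact: (natural_filtration_measurable LX (s := s)) mB.
apply: (integralM_indep mU mV) => // A B mA mB.
exact: (levy_indep_past LX).
Qed.

(** The indicator of a small increment is independent of [y] and has expectation at least 1/2. *)
Lemma past_half_le (s t r : R) (y : Omega -> \bar R) :
  0 <= s -> s <= t -> measurable_fun setT (y : past X s -> \bar R) ->
  (forall w, 0 <= y w)%E ->
  (2^-1%:E <= P (X (t - s) @^-1` [set x | (`|x| <= r)%R]))%E ->
  (2^-1%:E * \int[P]_w y w <=
   \int[P]_w (y w * (\1_[set x : 'rV[R]_d | (`|x| <= r)%R] (X t w - X s w)%R)%:E))%E.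
Proof.
move=> s0 st my y0 half.
rewrite (@levy_integralM _ _ y
  (fun x => (\1_[set x : 'rV[R]_d | (`|x| <= r)%R] x)%:E))//; last first.
  apply/measurable_EFinP; apply: measurable_indic; exact: measurable_norm_le.
rewrite muleC lee_wpmul2l//; first exact: integral_ge0.
have ts0 : 0 <= t - s by rewrite subr_ge0.
rewrite [X in (_ <= X)%E](_ : _ = P (X (t - s) @^-1` [set x | (`|x| <= r)%R]))//.
rewrite -[in RHS](setIT (_ @^-1` _)) -integral_indic//.
rewrite -[X in measurable X]setTI; apply: (levy_measurable LX) => //.
exact: measurable_norm_le.
Qed.

Lemma measurable_past (s : R) :
  0 <= s -> measurable_fun setT (X s : past X s -> 'rV[R]_d).
Proof.
move=> s0 _ B mB; apply: sub_sigma_algebra; exists s; last by exists B.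
by rewrite /= in_itv /= s0 lexx.
Qed.

Context {g : 'rV[R]_d -> R}.
Context (gsub : submultiplicative g) (gloc : locally_bounded g).

Let g0 : forall x, 0 <= g x. Proof. by case: gsub. Qed.
Let mg : measurable_fun setT g. Proof. by case: gsub. Qed.

Lemma moment_measurable (s : R) :
  0 <= s -> measurable_fun setT (fun w => (g (X s w))%:E).
Proof.
move=> s0; apply/measurable_EFinP; apply: (measurableT_comp mg).
exact: (levy_measurable LX).
Qed.

Lemma measurable_indic_increment (s t r : R) : 0 <= s -> 0 <= t ->
  measurable_fun setT
    (fun w => \1_[set x : 'rV[R]_d | `|x| <= r] (X t w - X s w) : R).
Proof.
move=> s0 t0; have mI : measurable_fun setT (\1_[set x : 'rV[R]_d | `|x| <= r] : _ -> R).
  by apply: measurable_indic; exact: measurable_norm_le.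
exact: measurableT_comp mI (levy_increment_measurable LX s0 t0).
Qed.

(** When [|X t - X s| <= r], [g (X s)] is at most [K * g (X t)]; restricting to this event loses at
    most half of the moment at [s]. *)
Lemma moment_decr (s t : R) : 0 <= s -> s <= t ->
  (\int[P]_w (g (X t w))%:E < +oo)%E -> (\int[P]_w (g (X s w))%:E < +oo)%E.
Proof.
move=> s0 st; have t0 := le_trans s0 st.
have [r hr] := levy_tight LX t.
have [K K0 gK] := submultiplicative_comparable r gsub gloc.
have mgp : measurable_fun setT ((fun w => (g (X s w))%:E) : past X s -> \bar R).
  by apply/measurable_EFinP; apply: (measurableT_comp mg); exact: measurable_past.
have half : (2^-1%:E <= P (X (t - s) @^-1` [set x | (`|x| <= r)%R]))%E.
  by apply: hr; rewrite subr_ge0 st lerBlDr lerDl.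
have le1 := past_half_le s0 st mgp (fun w => g0 (X s w)) half.
have le2 : (\int[P]_w ((g (X s w))%:E *
      (\1_[set x : 'rV[R]_d | (`|x| <= r)%R] (X t w - X s w)%R)%:E) <=
    K%:E * \int[P]_w (g (X t w))%:E)%E.
  rewrite -ge0_integralZl//; [|exact: moment_measurable|by move=> w _; rewrite lee_fin].
  apply: ge0_le_integral => //.
  - by move=> w _; rewrite -EFinM lee_fin mulr_ge0.
  - apply: emeasurable_funM; first exact: moment_measurable.
    by apply/measurable_EFinP; exact: measurable_indic_increment.
  - by apply: measurable_funeM; exact: moment_measurable.
  - move=> w _; rewrite -!EFinM lee_fin indicE; case: (boolP (_ \in _)).
      by rewrite inE mulr1 => /gK.
    by move=> _; rewrite mulr0 mulr_ge0.
move=> gt_fin; have := le_lt_trans (le_trans le1 le2) (_ : _ < +oo)%E.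
rewrite lte_pdivrMl// mulry gtr0_sg// mul1e; apply.
by apply: lte_mul_pinfty => //; rewrite lee_fin.
Qed.

(** [X (s + s)] is [X s] plus an independent copy of it, so submultiplicativity bounds its moment by
    [c] times the square of the moment at [s]. *)
Lemma moment_double (s : R) : 0 <= s ->
  (\int[P]_w (g (X s w))%:E < +oo)%E ->
  (\int[P]_w (g (X (s + s) w))%:E < +oo)%E.
Proof.
move=> s0 fin_s; have [_ _ [c c1 gM]] := gsub.
have c0 : 0 <= c by exact: le_trans c1.
have ss : s <= s + s by rewrite lerDl.
have s20 := addr_ge0 s0 s0.
have mg1 : measurable_fun setT (fun w => (g (X (s + s) w - X s w))%:E).
  apply/measurable_EFinP; apply: (measurableT_comp mg).
  exact: (levy_increment_measurable LX).
have mgp : measurable_fun setT ((fun w => (g (X s w))%:E) : past X s -> \bar R).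
  by apply/measurable_EFinP; apply: (measurableT_comp mg); exact: measurable_past.
have fin0 : (0 <= \int[P]_w (g (X s w))%:E)%E.
  by apply: integral_ge0 => w _; rewrite lee_fin.
apply: (@le_lt_trans _ _
    (c%:E * (\int[P]_w (g (X s w))%:E * \int[P]_w (g (X s w))%:E))%E); last first.
  rewrite lte_mul_pinfty ?lee_fin// lte_mul_pinfty//.
  by rewrite ge0_fin_numE.
have := @levy_integralM s (s + s) _ (EFin \o g) s0 ss mgp.
rewrite addrK /= => <-//; last 2 first.
- exact/measurable_EFinP.
- by move=> x; rewrite lee_fin.
rewrite -ge0_integralZl//; last 2 first.
- by apply: emeasurable_funM => //; exact: moment_measurable.
- by move=> w _; rewrite -EFinM lee_fin mulr_ge0.
apply: ge0_le_integral => //.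
- by move=> w _; rewrite lee_fin.
- exact: moment_measurable.
- by apply: measurable_funeM; apply: emeasurable_funM => //; exact: moment_measurable.
- move=> w _; rewrite -!EFinM lee_fin mulrA.
  by rewrite -{1}(subrK (X s w) (X (s + s) w)) addrC gM.
Qed.

Lemma moment_finite (t0 : R) : 0 < t0 ->
  (\int[P]_w (g (X t0 w))%:E < +oo)%E ->
  forall t, 0 <= t -> (\int[P]_w (g (X t w))%:E < +oo)%E.
Proof.
move=> t00 fin0 t t_ge0.
have fin_pow n : (\int[P]_w (g (X (2 ^+ n * t0) w))%:E < +oo)%E.
  elim: n => [|n IHn]; first by rewrite expr0 mul1r.
  rewrite exprS -mulrA mulr2n mulrDl mul1r; apply: moment_double => //.
  by rewrite mulr_ge0// ltW.
(* This choice gives [t / t0 < n < 2 ^+ n], so the doubled time lies beyond [t]. *)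
pose n := (Num.truncn (t / t0)).+1.
apply: (moment_decr t_ge0 _ (fin_pow n)).
rewrite -ler_pdivrMr//; apply/ltW/(lt_trans (truncnS_gt _)).
by rewrite -natrX ltr_nat ltn_expl.
Qed.

End LevyMoments.

(** * The bound at a stopping time *)

Section StoppedBound.
Context {dO : measure_display} {Omega : measurableType dO} {R : realType}.
Context {P : probability Omega R} {d : nat} {X : R -> Omega -> 'rV[R]_d}.
Context (LX : levy_process P X).

Context {M : R -> Omega -> R} (tau : Omega -> \bar R).
Context (tauS : stopping_time (natural_filtration X) tau).
Context (SM : martingale P (natural_filtration X) (stopped M tau)).

Definition reached (u : R) : set Omega := [set w | (tau w <= u%:E)%E].

Lemma reached_past (u : R) : 0 <= u ->
  measurable_fun setT (\1_(reached u) : past X u -> R).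
Proof. by move=> u0; apply: measurable_indic; exact: tauS.2. Qed.

(** Adaptedness of the stopped process comes from its being a martingale, not from any path
    regularity of [M]. *)
Lemma stopped_past (u : R) : 0 <= u ->
  measurable_fun setT (stopped M tau u : past X u -> R).
Proof.
by move=> u0 _ B mB; rewrite setTI; exact: (martingale_adapted SM).
Qed.

Lemma past_mono (u v : R) (y : Omega -> R) : u <= v ->
  measurable_fun setT (y : past X u -> R) -> measurable_fun setT (y : past X v -> R).
Proof.
move=> uv my _ B mB; have := my measurableT B mB.
apply: sub_sigma_algebra2; apply: bigcup_subset => s /=.
by rewrite !in_itv /= => /andP[-> /le_trans]; apply.
Qed.

Lemma past_measurable (u : R) (y : Omega -> R) :
  measurable_fun setT (y : past X u -> R) -> measurable_fun setT y.
Proof.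
move=> my _ B mB; have := my measurableT B mB.
exact: (natural_filtration_measurable LX).
Qed.

Lemma stopped_reached (u v : R) (w : Omega) : reached u w -> reached v w ->
  stopped M tau u w = stopped M tau v w.
Proof. by move=> uw vw; rewrite /stopped !min_r. Qed.

(** For nondecreasing [u], the indicator of [u (j - 1) < tau <= u j], or of [tau <= u 0] when
    [j = 0]. The difference form makes the sum over [j] telescope. *)
Definition slab (u : nat -> R) (j : nat) (w : Omega) : R :=
  \1_(reached (u j)) w - (if j is i.+1 then \1_(reached (u i)) w else 0).

Lemma sum_slab (u : nat -> R) (n : nat) (w : Omega) :
  \sum_(j < n.+1) slab u j w = \1_(reached (u n)) w.
Proof.
(* With this shift and [a 0 = 0], [slab u j] is [a j.+1 - a j]. *)
pose a j := if j is i.+1 then \1_(reached (u i)) w else 0 : R.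
rewrite -(big_mkord xpredT (fun j => slab u j w)).
by rewrite (telescope_sumr a)//= subr0.
Qed.

(** The equation [j = i.+1] leaves the last clause vacuous at [j = 0], where no earlier grid point
    exists. *)
Lemma slabP (u : nat -> R) (j : nat) (w : Omega) : nondecreasing_seq u ->
  slab u j w = 0 \/ [/\ slab u j w = 1, reached (u j) w &
    forall i, j = i.+1 -> ~ reached (u i) w].
Proof.
move=> ndu; rewrite /slab !indicE.
have [|Nj] := boolP (w \in reached (u j)).
  rewrite inE => wj; case: j wj => [|i] wj.
    by right; split => //; rewrite subr0.
  rewrite indicE; have [|Ni] := boolP (w \in reached (u i)).
    by left; rewrite subrr.
  right; split => //; first by rewrite subr0.
  by move=> _ [<-] wi; move: Ni; rewrite mem_set.
left; case: j Nj => [|i] Nj; first by rewrite subr0.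
rewrite indicE memNset ?subr0// => wi; move/negP: Nj; apply.
by rewrite inE /reached /=; apply: (le_trans wi); rewrite lee_fin ndu.
Qed.

Lemma slab_ge0 (u : nat -> R) (j : nat) (w : Omega) : nondecreasing_seq u ->
  0 <= slab u j w.
Proof. by move=> ndu; have [->|[->]] := slabP j w ndu. Qed.

Lemma slab_past (u : nat -> R) (j : nat) : (forall i, 0 <= u i) ->
  nondecreasing_seq u -> measurable_fun setT (slab u j : past X (u j) -> R).
Proof.
move=> u0 ndu; apply: measurable_funB; first exact: reached_past.
case: j => [|i]; first exact: measurable_cst.
by apply: (@past_mono (u i)); [exact: ndu|exact: reached_past].
Qed.

(** When [tau <= u n] and [u] is nondecreasing, exactly one slab contributes, and its [u j] is the
    first grid point at or after [tau]. The stopped value is kept exact; only the increment is taken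
    from [u j]. *)
Definition grid_sum (t r : R) (u : nat -> R) (n : nat) (w : Omega) : R :=
  \sum_(j < n.+1) `|stopped M tau t w| * slab u j w *
    \1_[set x : 'rV[R]_d | `|x| <= r] (X t w - X (u j) w).

(** On slab [j] one has [tau <= u j <= t], so the values stopped at [t] and at [u j] coincide. The
    summand without its increment indicator is thus measurable in the past of [u j], and
    [past_half_le] applies slab by slab. *)
Lemma grid_sum_half (t r : R) (u : nat -> R) (n : nat) :
  (forall v, 0 <= v <= t ->
    (2^-1%:E <= P (X v @^-1` [set x | (`|x| <= r)%R]))%E) ->
  (forall i, 0 <= u i) -> nondecreasing_seq u -> u n = t ->
  (2^-1%:E * \int[P]_w (`|stopped M tau t w| * \1_(reached t) w)%:E <=
   \int[P]_w (grid_sum t r u n w)%:E)%E.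
Proof.
move=> hr u0 ndu unt; have t0 : 0 <= t by rewrite -unt.
have ut (j : 'I_n.+1) : u j <= t by rewrite -unt ndu// -ltnS.
pose y j w := `|stopped M tau t w| * slab u j w.
have y0 j w : 0 <= y j w by rewrite mulr_ge0// slab_ge0.
have yE j w : u j <= t -> y j w = `|stopped M tau (u j) w| * slab u j w.
  move=> ujt; rewrite /y; have [->|[_ wj _]] := slabP j w ndu; first by rewrite !mulr0.
  rewrite (@stopped_reached t (u j))//.
  by apply: (le_trans wj); rewrite lee_fin.
have my (j : 'I_n.+1) : measurable_fun setT (y j : past X (u j) -> R).
  rewrite (_ : y j = fun w => `|stopped M tau (u j) w| * slab u j w); last first.
    by apply/funext => w; rewrite yE.
  apply: measurable_funM; last exact: slab_past.
  by apply: measurableT_comp => //; exact: stopped_past.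
have my' (j : 'I_n.+1) : measurable_fun setT (y j).
  exact: (past_measurable (my j)).
have ysum w : (`|stopped M tau t w| * \1_(reached t) w)%:E =
    (\sum_(j < n.+1) (y j w)%:E)%E.
  by rewrite sumEFin -mulr_sumr sum_slab unt.
under eq_integral do rewrite ysum.
rewrite ge0_integral_sum//; last 2 first.
- by move=> j; apply/measurable_EFinP; exact: my'.
- by move=> j w _; rewrite lee_fin y0.
rewrite /grid_sum; under [X in (_ <= X)%E]eq_integral do rewrite -sumEFin.
rewrite ge0_integral_sum//; last 2 first.
- move=> j; apply/measurable_EFinP; apply: measurable_funM; first exact: my'.
  exact: (measurable_indic_increment LX).
- by move=> j w _; rewrite lee_fin mulr_ge0 ?y0.
rewrite ge0_sume_distrr; last first.
  by move=> j _; apply: integral_ge0 => w _; rewrite lee_fin y0.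
apply: lee_sum => j _.
under [X in (_ <= X)%E]eq_integral do rewrite EFinM.
apply: (past_half_le LX) => //.
- exact/measurable_EFinP.
- by move=> w; rewrite lee_fin y0.
- by apply: hr; rewrite subr_ge0 ut lerBlDr lerDl u0.
Qed.

Lemma reachedE (t : R) (w : Omega) : reached t w ->
  exists2 v : R, tau w = v%:E & 0 <= v <= t.
Proof.
rewrite /reached /=; have := tauS.1 w; case: (tau w) => // v; rewrite !lee_fin => v0 vt.
by exists v; rewrite ?v0.
Qed.

Lemma stopped_reachedE (t v : R) (w : Omega) : tau w = v%:E -> v <= t ->
  stopped M tau t w = M v w.
Proof. by move=> tv vt; rewrite /stopped tv min_r ?lee_fin. Qed.

Lemma grid_sum_ge0 (t r : R) (u : nat -> R) (n : nat) (w : Omega) :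
  nondecreasing_seq u -> 0 <= grid_sum t r u n w.
Proof.
move=> ndu; apply: sumr_ge0 => j _; rewrite mulr_ge0// mulr_ge0//.
exact: slab_ge0.
Qed.

Lemma grid_sum_le (t r : R) (u : nat -> R) (n : nat) (w : Omega) :
  nondecreasing_seq u -> u n = t ->
  grid_sum t r u n w <= `|stopped M tau t w| * \1_(reached t) w.
Proof.
move=> ndu unt; rewrite -unt -sum_slab mulr_sumr unt; apply: ler_sum => j _.
by rewrite ler_piMr// ?mulr_ge0 ?slab_ge0.
Qed.

Let grid (t : R) (n j : nat) : R := t * (j%:R / n%:R).

Lemma grid_ge0 (t : R) (n j : nat) : 0 <= t -> 0 <= grid t n j.
Proof. by move=> t0; rewrite mulr_ge0// divr_ge0. Qed.

Lemma grid_nondecreasing (t : R) (n : nat) : 0 <= t -> nondecreasing_seq (grid t n).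
Proof. by move=> t0 i j ij; rewrite ler_wpM2l// ler_wpM2r ?invr_ge0// ler_nat. Qed.

(** The successor keeps the denominator nonzero; at [n = 0] the quotient [0 / 0] would be 0. *)
Lemma grid_end (t : R) (n : nat) : grid t n.+1 n.+1 = t.
Proof. by rewrite /grid divff ?mulr1// pnatr_eq0. Qed.

Lemma gridS (t : R) (n j : nat) : grid t n j.+1 = grid t n j + t / n%:R.
Proof. by rewrite /grid -natr1 mulrDl mul1r mulrDr. Qed.

(* By right-continuity, the increment from the grid point just after [tau] is
   also larger than [r] once the grid is fine enough. *)
Lemma grid_sum_eventually0 (t r v : R) (w : Omega) :
  0 <= t -> tau w = v%:E -> 0 <= v <= t -> r < `|X t w - X v w| ->
  \forall n \near \oo, grid_sum t r (grid t n.+1) n.+1 w = 0.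
Proof.
move=> t0 tauv /andP[v0 vt] rX.
have : \forall s \near v^'+, r < `|X t w - X s w|.
  have cX : `|X t w - X s w| @[s --> v^'+] --> `|X t w - X v w|.
    apply: cvg_norm; apply: cvgB; first exact: cvg_cst.
    exact: (levy_cadlag LX w).1.
  exact: (cvgr_gt _ cX).
case=> e /= e0 He.
have He' s : v <= s -> s < v + e -> r < `|X t w - X s w|.
  rewrite le_eqVlt => /predU1P[<-//|vs sve]; apply: He => //=.
  by rewrite distrC gtr0_norm ?subr_gt0// ltrBlDl.
near=> n.
have tn : t / n.+1%:R < e.
  rewrite ltr_pdivrMr// mulrC -ltr_pdivrMr//.
  by apply: lt_trans (truncnS_gt _) _; rewrite ltr_nat ltnS; near: n;
    exact: nbhs_infty_ge.
apply: big1 => j _.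
have [->|[_ wj wi]] := slabP j w (@grid_nondecreasing t n.+1 t0).
  by rewrite mulr0 mul0r.
rewrite indicE memNset ?mulr0//= => /le_gtF; rewrite He'//.
  by move: wj; rewrite /reached /= tauv lee_fin.
(* The first grid point is [0 <= v]. Any other one exceeds its predecessor, which lies before [tau],
   by one mesh width, so it is below [v + e]. *)
case: (nat_of_ord j) wi {wj} => [|i] wi.
  by rewrite /grid mul0r mulr0 ltr_wpDl.
rewrite gridS ltrD// ltNge; apply/negP => vi; apply: (wi i erefl).
by rewrite /reached /= tauv lee_fin.
Unshelve. all: by end_near. Qed.

(** The comparison with [G] is assumed at deterministic times but for every [w], so it may be used
    at [v = tau w]. *)
Lemma stopped_bound (t r : R) (G : Omega -> R) : 0 <= t ->
  (forall v, 0 <= v <= t ->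
    (2^-1%:E <= P (X v @^-1` [set x | (`|x| <= r)%R]))%E) ->
  (forall w, 0 <= G w) -> measurable_fun setT G ->
  (\int[P]_w (G w)%:E < +oo)%E ->
  (forall v w, 0 <= v <= t -> `|X t w - X v w| <= r -> `|M v w| <= G w) ->
  (2^-1%:E * \int[P]_w (`|stopped M tau t w| * \1_(reached t) w)%:E <=
   \int[P]_w (G w * \1_(reached t) w)%:E)%E.
Proof.
move=> t0 hr G0 mG Gfin MG.
pose u n := grid t n.+1; pose I n := grid_sum t r (u n) n.+1.
(* [I n] itself need not converge where [|X t - X tau| = r]. Only its excess over the target is
   followed: it is 0 when the true increment is at most [r], and eventually 0 when it is larger,
   since then [I n] vanishes. *)
pose h n w := Num.max 0 (I n w - G w * \1_(reached t) w).
have ndu n : nondecreasing_seq (u n) by exact: grid_nondecreasing.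
have u0 n i : 0 <= u n i by exact: grid_ge0.
have unt n : u n n.+1 = t by exact: grid_end.
have mreached v : 0 <= v -> measurable_fun setT (\1_(reached v) : Omega -> R).
  by move=> v0; apply: (past_measurable (u := v)); exact: reached_past.
have mstopped : measurable_fun setT (stopped M tau t).
  by apply: (past_measurable (u := t)); exact: stopped_past.
have mI n : measurable_fun setT (I n).
  apply: measurable_sum => j; apply: measurable_funM.
    apply: measurable_funM; first exact: measurableT_comp.
    by apply: (past_measurable (u := u n j)); exact: slab_past.
  exact: (measurable_indic_increment LX).
have mG1 : measurable_fun setT (fun w => G w * \1_(reached t) w).
  by apply: measurable_funM => //; exact: mreached.
have mh n : measurable_fun setT (h n).
  by apply: measurable_maxr => //; exact: measurable_funB.
have h_ge0 n w : 0 <= h n w by rewrite le_max lexx.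
have ind_le1 (A : set Omega) w : \1_A w <= 1 :> R by rewrite indicE; case: (_ \in _).
have h_le n w : h n w <= `|stopped M tau t w|.
  rewrite ge_max normr_ge0 /= lerBlDr (le_trans (grid_sum_le _ _ (ndu n) (unt n)))//.
  by rewrite ler_wpDr// ?mulr_ge0// ler_piMr.
have h_cvg w : h n w @[n --> \oo] --> 0.
  apply: cvg_near_cst.
  have [wt|Nwt] := pselect (reached t w); last first.
    near=> n; apply/max_idPl; rewrite subr_le0 indicE memNset// mulr0.
    rewrite (le_trans (grid_sum_le _ _ (ndu n) (unt n)))//.
    by rewrite indicE memNset// mulr0.
  have [v tauv vt] := reachedE wt.
  have [Xr|rX] := leP `|X t w - X v w| r.
    near=> n; apply/max_idPl; rewrite subr_le0.
    rewrite (le_trans (grid_sum_le _ _ (ndu n) (unt n)))// ler_wpM2r//.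
    by have /andP[_ /(stopped_reachedE tauv)->] := vt; exact: MG.
  have := grid_sum_eventually0 t0 tauv vt rX.
  apply: filterS => n In0; apply/max_idPl; rewrite /I In0 sub0r oppr_le0.
  by rewrite mulr_ge0.
have inth : (\int[P]_w (h n w)%:E @[n --> \oo] --> 0)%E.
  have [|||||_ _] := @dominated_convergence _ _ _ P setT measurableT
    (fun n => EFin \o h n) (cst 0%E) (fun w => `|(stopped M tau t w)%:E|%E).
  - by move=> n; apply/measurable_EFinP.
  - exact: measurable_cst.
  - by apply/aeW => w _; apply/fine_cvgP; split; [near=> n|exact: h_cvg].
  - by apply: integrable_abse; exact: (martingale_integrable SM).
  - apply/aeW => w n _ /=; rewrite lee_fin ger0_norm//.
  by rewrite integral0.
(* Since [I n] is at most the target integrand plus [h n], each term of this sequence bounds the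
   left-hand side. *)
have cvgR : (\int[P]_w (G w * \1_(reached t) w)%:E + \int[P]_w (h n w)%:E
    @[n --> \oo] --> \int[P]_w (G w * \1_(reached t) w)%:E)%E.
  rewrite -[X in _ --> X]adde0; apply: cvgeD => //; last exact: cvg_cst.
  by rewrite fin_num_adde_defl.
apply: (cvge_to_ge cvgR); near=> n.
apply: (le_trans (grid_sum_half hr (u0 n) (ndu n) (unt n))).
rewrite -ge0_integralD//; last 4 first.
- by move=> w _; rewrite lee_fin mulr_ge0.
- exact/measurable_EFinP.
- by move=> w _; rewrite lee_fin.
- exact/measurable_EFinP.
apply: ge0_le_integral => //.
- by move=> w _; rewrite lee_fin; exact: grid_sum_ge0.
- by apply/measurable_EFinP; exact: mI.
- by apply: emeasurable_funD; exact/measurable_EFinP.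
- by move=> w _; rewrite -EFinD lee_fin -lerBlDl le_max lexx orbT.
Unshelve. all: by end_near. Qed.
End StoppedBound.

(** * From local martingale to martingale *)

(** The integrals over [A] differ by at most the integral of [|Y_ n - Y|] over the whole space. *)
Lemma L1_cvg_integral (dO : measure_display) (Omega : measurableType dO)
    (R : realType) (mu : {measure set Omega -> \bar R}) (A : set Omega)
    (Y_ : nat -> Omega -> R) (Y : Omega -> R) :
  measurable A -> (forall n, mu.-integrable setT (EFin \o Y_ n)) ->
  mu.-integrable setT (EFin \o Y) ->
  (\int[mu]_w `|Y_ n w - Y w|%:E @[n --> \oo] --> 0)%E ->
  (\int[mu]_(w in A) (Y_ n w)%:E @[n --> \oo] --> \int[mu]_(w in A) (Y w)%:E)%E.
Proof.
move=> mA iY_ iY L1.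
have iA (Z : Omega -> R) : mu.-integrable setT (EFin \o Z) ->
    mu.-integrable A (EFin \o Z) by exact: integrableS.
apply/sube_cvg0; first exact: integrable_fin_num (iA _ iY).
apply/cvg_abse0P; apply: squeeze_cvge (cvg_cst 0%E) L1.
near=> n; rewrite abse_ge0 /= -integralB_EFin//; [|exact: iA..].
have mD : measurable_fun setT (fun w => (Y_ n w - Y w)%:E).
  apply/measurable_EFinP; apply: measurable_funB; apply/measurable_EFinP.
    exact: measurable_int (iY_ n).
  exact: measurable_int iY.
under eq_integral do rewrite -EFinB.
apply: (le_trans (le_abse_integral _ _ _)) => //; first exact: measurable_funS mD.
apply: ge0_subset_integral => //.
exact: measurableT_comp mD.
Unshelve. all: by end_near. Qed.

Section LocalMartingale.
Context {dO : measure_display} {Omega : measurableType dO} {R : realType}.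
Context {P : probability Omega R} {d : nat} {X : R -> Omega -> 'rV[R]_d}.
Context {f g : 'rV[R]_d -> R}.
Context (LX : levy_process P X) (mf : measurable_fun setT f).
Context (gsub : submultiplicative g) (gloc : locally_bounded g).
Context (fg : forall x, `|f x| <= g x).
Context (gfin : forall t, 0 <= t -> (\int[P]_w (g (X t w))%:E < +oo)%E).

Let M (t : R) (w : Omega) := f (X t w).
Let g0 : forall x, 0 <= g x. Proof. by case: gsub. Qed.
Let mg : measurable_fun setT g. Proof. by case: gsub. Qed.

Lemma integrable_M (t : R) : 0 <= t -> P.-integrable setT (EFin \o M t).
Proof.
move=> t0; apply: (@le_integrable _ _ _ _ _ measurableT _ (fun w => (g (X t w))%:E)).
- apply/measurable_EFinP; apply: (measurableT_comp mf).
  exact: (levy_measurable LX).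
- by move=> w _; rewrite /= lee_fin (le_trans (fg _))// ler_norm.
- apply/integrableP; split; first exact: (moment_measurable LX gsub).
  under eq_integral do rewrite /= ger0_norm//.
  exact: gfin.
Qed.

(** The difference vanishes unless [tau <= t], and there it is at most
    [|stopped M tau t| + g (X t)]. [C] is chosen before [tau], so one constant serves a whole
    localising sequence. *)
Lemma stopped_L1_bound (t : R) : 0 <= t ->
  exists2 C : R, 0 <= C & forall tau : Omega -> \bar R,
    stopping_time (natural_filtration X) tau ->
    martingale P (natural_filtration X) (stopped M tau) ->
    (\int[P]_w `|stopped M tau t w - M t w|%:E <=
     C%:E * \int[P]_w (g (X t w) * \1_(reached tau t) w)%:E)%E.
Proof.
move=> t0; have [r hr] := levy_tight LX t.
have [K K0 gK] := submultiplicative_comparable r gsub gloc.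
(* [2 * K] accounts for the stopped value, with the 2 undoing the factor 1/2 of [stopped_bound], and
   1 for [|M t| <= g (X t)]. *)
exists (2 * K + 1); first by rewrite addr_ge0// mulr_ge0.
move=> tau tauS SM.
have mgX := moment_measurable LX gsub t0.
have mreached : measurable_fun setT (\1_(reached tau t) : Omega -> R).
  by apply: (past_measurable LX (u := t)); exact: reached_past.
have mstopped : measurable_fun setT (stopped M tau t).
  by apply: (past_measurable LX (u := t)); have := stopped_past SM t0.
have mM : measurable_fun setT (M t).
  by apply: (measurableT_comp mf); exact: (levy_measurable LX).
have mgr : measurable_fun setT (fun w => (g (X t w) * \1_(reached tau t) w)%:E).
  by apply/measurable_EFinP; apply: measurable_funM => //; apply/measurable_EFinP.
have msr : measurable_fun setT (fun w =>
    (`|stopped M tau t w| * \1_(reached tau t) w)%:E).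
  by apply/measurable_EFinP; apply: measurable_funM => //; exact: measurableT_comp.
have gr0 w : (0 <= (g (X t w) * \1_(reached tau t) w)%:E)%E.
  by rewrite lee_fin mulr_ge0.
have sr0 w : (0 <= (`|stopped M tau t w| * \1_(reached tau t) w)%:E)%E.
  by rewrite lee_fin mulr_ge0.
have KE : (\int[P]_w (K * g (X t w))%:E = K%:E * \int[P]_w (g (X t w))%:E)%E.
  under eq_integral do rewrite EFinM.
  by rewrite ge0_integralZl// => w _; rewrite lee_fin.
have half : (2^-1%:E * \int[P]_w (`|stopped M tau t w| * \1_(reached tau t) w)%:E <=
    \int[P]_w (K * g (X t w) * \1_(reached tau t) w)%:E)%E.
  (* Here [G] is [K * g (X t)], which dominates [g (X v)] and hence [|f (X v)|] when the increment
     from [v] to [t] is at most [r]. *)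
  apply: (stopped_bound LX tauS SM t0 hr).
  - by move=> w; rewrite mulr_ge0.
  - by apply: measurable_funM => //; apply/measurable_EFinP.
  - by rewrite KE lte_mul_pinfty ?lee_fin// gfin.
  - by move=> v w _ /gK; apply: le_trans; exact: fg.
apply: (@le_trans _ _ (\int[P]_w (`|stopped M tau t w| * \1_(reached tau t) w)%:E +
    \int[P]_w (g (X t w) * \1_(reached tau t) w)%:E)%E).
  rewrite -ge0_integralD//; apply: ge0_le_integral => //.
  - apply/measurable_EFinP; apply: measurableT_comp => //.
    exact: measurable_funB.
  - exact: emeasurable_funD.
  - move=> w _; rewrite -EFinD lee_fin -mulrDl indicE.
    have [wt|] := boolP (w \in reached tau t).
      by rewrite mulr1 (le_trans (ler_normB _ _))// lerD2l fg.
    rewrite mulr0 => /negP wt; rewrite /stopped min_l ?subrr ?normr0//.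
    by rewrite leNgt; apply/negP => /ltW tw; apply: wt; rewrite inE.
rewrite EFinD ge0_muleDl ?lee_fin// ?mulr_ge0// mul1e leeD2r//.
have KgE : (\int[P]_w (K * g (X t w) * \1_(reached tau t) w)%:E =
    K%:E * \int[P]_w (g (X t w) * \1_(reached tau t) w)%:E)%E.
  by rewrite -ge0_integralZl//; under [RHS]eq_integral do rewrite -EFinM mulrA.
by move: half; rewrite lee_pdivrMl// KgE muleA -EFinM.
Qed.

(** Almost surely [tau n] eventually exceeds the fixed [t], so the indicator vanishes; [g (X t)]
    dominates. *)
Lemma moment_reached_cvg0 (tau : nat -> Omega -> \bar R) (t : R) : 0 <= t ->
  (forall n, stopping_time (natural_filtration X) (tau n)) ->
  {ae P, forall w, tau n w @[n --> \oo] --> +oo%E} ->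
  (\int[P]_w (g (X t w) * \1_(reached (tau n) t) w)%:E @[n --> \oo] --> 0)%E.
Proof.
move=> t0 tauS tauoo.
have mgX := moment_measurable LX gsub t0.
have [|||||_ _] := @dominated_convergence _ _ _ P setT measurableT
  (fun n w => (g (X t w) * \1_(reached (tau n) t) w)%:E) (cst 0%E)
  (fun w => (g (X t w))%:E).
- move=> n; apply/measurable_EFinP; apply: measurable_funM; first exact/measurable_EFinP.
  by apply: (past_measurable LX (u := t)); exact: reached_past.
- exact: measurable_cst.
- apply: filterS tauoo => w /cvgey_gt/(_ t) tw _.
  apply: cvg_near_cst; apply: filterS tw => n tw.
  by rewrite indicE memNset ?mulr0// /reached /= leNgt tw.
- apply/integrableP; split => //.
  under eq_integral do rewrite /= ger0_norm//.
  exact: gfin.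
- apply/aeW => w n _; rewrite abse_EFin lee_fin ger0_norm ?mulr_ge0//.
  by rewrite ler_piMr// indicE; case: (_ \in _).
by rewrite integral0.
Qed.

(** This is the form in which the L^1 convergence enters the conditional expectation identity, at
    both of its times. *)
Lemma stopped_integral_cvg (tau : nat -> Omega -> \bar R) (t : R) (A : set Omega) :
  0 <= t -> measurable A ->
  (forall n, stopping_time (natural_filtration X) (tau n)) ->
  {ae P, forall w, tau n w @[n --> \oo] --> +oo%E} ->
  (forall n, martingale P (natural_filtration X) (stopped M (tau n))) ->
  (\int[P]_(w in A) (stopped M (tau n) t w)%:E @[n --> \oo] -->
   \int[P]_(w in A) (M t w)%:E)%E.
Proof.
move=> t0 mA tauS tauoo SM.
have [C C0 boundC] := stopped_L1_bound t0.
apply: L1_cvg_integral => //.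
- by move=> n; exact: (martingale_integrable (SM n)).
- exact: integrable_M.
have J0 : (C%:E * \int[P]_w (g (X t w) * \1_(reached (tau n) t) w)%:E
    @[n --> \oo] --> 0)%E.
  by rewrite -(mule0 C%:E); apply: cvgeZl => //; exact: moment_reached_cvg0.
apply: squeeze_cvge (cvg_cst 0%E) J0.
near=> n; rewrite boundC// andbT.
by apply: integral_ge0 => w _; rewrite lee_fin.
Unshelve. all: by end_near. Qed.

End LocalMartingale.

Theorem corollary10 (R : realType) (dO : measure_display)
    (Omega : measurableType dO) (P : probability Omega R) (d : nat)
    (X : R -> Omega -> 'rV[R]_d) (f g : 'rV[R]_d -> R) :
  levy_process P X ->
  measurable_fun setT f ->
  submultiplicative g ->
  locally_bounded g ->
  (forall x, `|f x| <= g x) ->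
  (exists2 t, 0 < t & ('E_P[g \o X t] < +oo)%E) ->
  local_martingale P (natural_filtration X) (fun t w => f (X t w)) ->
  martingale P (natural_filtration X) (fun t w => f (X t w)).
Proof.
move=> LX mf gsub gloc fg [t0 t00 + ] [Madapted [tau [tauS _ tauoo SM]]].
rewrite unlock => gt0.
have gfin := moment_finite LX gsub gloc t00 gt0.
have iM := integrable_M LX mf gsub fg gfin.
split=> [||s t s0 st]; [exact: Madapted|exact: iM|].
have t_ge0 := le_trans s0 st.
split=> [||A FA]; [exact: Madapted|exact: iM|].
have mA : measurable A by exact: (natural_filtration_measurable LX FA).
have cvgA u : 0 <= u -> _ :=
  fun u0 => stopped_integral_cvg LX mf gsub gloc fg gfin u0 mA tauS tauoo SM.
(* For each [n] the stopped martingale has equal integrals over [A] at times [s] and [t], so the two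
   limits coincide. *)
apply: (cvg_unique _ (cvgA s s0)) => //.
rewrite (_ : (fun n => _) = (fun n => \int[P]_(w in A)
    (stopped (fun t w => f (X t w)) (tau n) t w)%:E)%E); first exact: cvgA.
by apply/funext => n; have [_ _ ->] := martingale_cond (SM n) s0 st.
Qed.
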